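(* Let $S, T \subseteq \mathbb{F}_2^n$ be finite. Then $S$ and $T$ are affinely equivalent if and only if there is a cardinality-preserving linear bijection $\mathrm{Venn}(S, E(S)) \to \mathrm{Venn}(T, E(T))$.
   Context: $S,T\subseteq\mathbb{F}_2^n$ are affinely equivalent if there is an affine automorphism $f$ of $\mathbb{F}_2^n$ with $f(S)=T$. For a finite set $S$, the power set $\mathcal{P}(S)$ is an $\mathbb{F}_2$-vector space with addition the symmetric difference $X \triangle Y=(X\cup Y)\setminus(X\cap Y)$ and zero $\varnothing$. For $S\subseteq\mathbb{F}_2^n$, $E(S)\subseteq\mathcal{P}(S)$ is the collection of even zero-sum subsets of $S$: subsets of even cardinality whose elements sum to $\vec 0$ (including $\varnothing$); it is a linear subspace of $\mathcal{P}(S)$. For a linear subspace $\mathcal{V}\le\mathcal{P}(S)$ with basis $\mathscr{X}=(X_1,\dots,X_r)$ and $\vec a\in\mathbb{F}_2^r$ with support $I_{\vec a}=\{i:a_i=1\}$, the Venn region indexed by $\vec a$ is $v_{\mathscr{X}}(\vec a)=\bigcap_{i\in I_{\vec a}}X_i\cap\bigcap_{i\notin I_{\vec a}}(S\setminus X_i)$ (regions with distinct indices are regarded as distinct, even if empty). $\mathrm{Venn}(S,\mathcal{V})$ denotes this indexed family of Venn regions, made into an $r$-dimensional $\mathbb{F}_2$-vector space by $v_{\mathscr{X}}(\vec a)+v_{\mathscr{X}}(\vec b)=v_{\mathscr{X}}(\vec a+\vec b)$. A cardinality-preserving linear bijection $\mathrm{Venn}(S,\mathcal{V})\to\mathrm{Venn}(T,\mathcal{W})$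 means: for bases $\mathscr{X}$ of $\mathcal{V}$ and $\mathscr{Y}$ of $\mathcal{W}$ (both of size $r$), an invertible $r\times r$ matrix $N$ over $\mathbb{F}_2$ with $|v_{\mathscr{Y}}(N\vec a)|=|v_{\mathscr{X}}(\vec a)|$ for all $\vec a\in\mathbb{F}_2^r$ (the existence of such $N$ does not depend on the choice of bases). *)

(* Defs.v *)
From HB Require Import structures.
From mathcomp Require Import all_boot all_order all_algebra.
Set Implicit Arguments. Unset Strict Implicit. Unset Printing Implicit Defensive.
Import GRing.Theory.
Local Open Scope ring_scope.

(* An alias of {set U} carrying the F_2-vector space structure given by        *)
(* symmetric difference. For S : {set U}, the subspaces of P(S) are the        *)
(* V : {vspace pset U} all of whose members are subsets of S.                  *)
Definition pset (U : finType) : Type := {set U}.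

Section PowerSetVectorSpace.
Variable U : finType.
Implicit Types (X Y Z : {set U}) (a b : 'F_2).

HB.instance Definition _ := Finite.copy (pset U) {set U}.

Definition symdiff X Y : {set U} := (X :|: Y) :\: (X :&: Y).

Lemma in_symdiff X Y u : (u \in symdiff X Y) = (u \in X) (+) (u \in Y).
Proof. by rewrite !inE; case: (u \in X); case: (u \in Y). Qed.

Fact symdiffA : associative symdiff.
Proof. by move=> X Y Z; apply/setP=> u; rewrite !in_symdiff addbA. Qed.
Fact symdiffC : commutative symdiff.
Proof. by move=> X Y; apply/setP=> u; rewrite !in_symdiff addbC. Qed.
Fact symdiff0 : left_id set0 symdiff.
Proof. by move=> X; apply/setP=> u; rewrite in_symdiff inE. Qed.
Fact symdiffN : left_inverse set0 id symdiff.
Proof. by move=> X; apply/setP=> u; rewrite in_symdiff inE addbb. Qed.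

HB.instance Definition _ :=
  GRing.isZmodule.Build (pset U) symdiffA symdiffC symdiff0 symdiffN.

Definition psetZ (a : 'F_2) (X : pset U) : pset U := if a == 0 then 0 else X.

Lemma F2_cases a : a = 0 \/ a = 1.
Proof.
by case: a => [[|[|m]]] lt_m //; [left | right]; apply: val_inj.
Qed.

Lemma pset_addXX (X : pset U) : X + X = 0.
Proof. exact: symdiffN. Qed.

Fact psetZA a b (X : pset U) : psetZ a (psetZ b X) = psetZ (a * b) X.
Proof.
by case: (F2_cases a) => ->; case: (F2_cases b) => ->.
Qed.
Fact psetZ1 : left_id 1 psetZ.
Proof. by []. Qed.
Fact psetZDr : right_distributive psetZ +%R.
Proof.
by move=> a X Y; case: (F2_cases a) => -> //; rewrite /psetZ /= addr0.
Qed.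
Fact psetZDl (X : pset U) : {morph psetZ^~ X : a b / a + b}.
Proof.
move=> a b; case: (F2_cases a) => ->; case: (F2_cases b) => ->;
  by rewrite /psetZ /= ?addr0 ?add0r ?pset_addXX.
Qed.

HB.instance Definition _ :=
  GRing.Zmodule_isLmodule.Build 'F_2 (pset U) psetZA psetZ1 psetZDr psetZDl.

Definition pset2rV (X : pset U) : 'rV['F_2]_#|U| :=
  \row_i (enum_val i \in (X : {set U}))%:R.
Definition rV2pset (v : 'rV['F_2]_#|U|) : pset U :=
  [set u | v 0 (enum_rank u) == 1].

Fact pset2rV_linear : linear pset2rV.
Proof.
move=> a X Y; apply/rowP=> i; rewrite !mxE.
case: (F2_cases a) => ->.
  by rewrite scale0r add0r mul0r add0r.
rewrite scale1r mul1r in_symdiff.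
by case: (_ \in X); case: (_ \in Y) => //; apply: val_inj.
Qed.

Fact pset2rV_bij : bijective pset2rV.
Proof.
exists rV2pset => [X | v].
  by apply/setP=> u; rewrite inE mxE enum_rankK; case: (u \in X).
apply/rowP=> i; rewrite mxE inE enum_valK.
by case: (F2_cases (v 0 i)) => ->.
Qed.

Fact pset_vect_axiom : Vector.axiom #|U| (pset U).
Proof. by exists pset2rV; [exact: pset2rV_linear | exact: pset2rV_bij]. Qed.

HB.instance Definition _ :=
  Lmodule_hasFinDim.Build 'F_2 (pset U) pset_vect_axiom.

Lemma pset0E : (0 : pset U) = set0.
Proof. by []. Qed.

Lemma psetDE (X Y : pset U) : X + Y = (X :|: Y) :\: (X :&: Y).
Proof. by []. Qed.

End PowerSetVectorSpace.

Definition affine_automorphism (n : nat)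
    (f : 'cV['F_2]_n -> 'cV['F_2]_n) : Prop :=
  exists2 A : 'M['F_2]_n, A \in unitmx &
    exists b : 'cV['F_2]_n, forall x, f x = A *m x + b.

Definition affinely_equivalent (n : nat) (S T : {set 'cV['F_2]_n}) : Prop :=
  exists2 f, affine_automorphism f & f @: S = T.

Definition even_zero_sum (n : nat) (S : {set 'cV['F_2]_n}) (X : {set 'cV['F_2]_n}) : bool :=
  [&& X \subset S, ~~ odd #|X| & \sum_(x in X) x == 0].

(* Taking the span only packages E(S) as a {vspace _}: no new element is       *)
(* added, see mem_E.                                                           *)
Definition E (n : nat) (S : {set 'cV['F_2]_n}) : {vspace pset 'cV['F_2]_n} :=
  <<enum [pred X : pset 'cV['F_2]_n | even_zero_sum S X]>>%VS.

Section MemE.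
Variables (n : nat) (S : {set 'cV['F_2]_n}).
Implicit Types X Y : pset 'cV['F_2]_n.

Lemma addvv_F2 (x : 'cV['F_2]_n) : x + x = 0.
Proof. by apply/colP=> i; rewrite !mxE; case: (F2_cases (x i 0)) => ->; apply: val_inj. Qed.

Lemma sum_symdiff X Y :
  \sum_(x in symdiff X Y) x = \sum_(x in X) x + \sum_(x in Y) x.
Proof.
rewrite !(big_mkcond (fun x => x \in _)) -big_split /=.
apply: eq_bigr => x _; rewrite in_symdiff.
by case: (x \in X); case: (x \in Y); rewrite /= ?addr0 ?add0r ?addvv_F2.
Qed.

Lemma odd_symdiff X Y : odd #|symdiff X Y| = odd #|X| (+) odd #|Y|.
Proof.
rewrite -!sum1_card !(big_mkcond (fun x => x \in _)) -oddD -big_split /=.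
elim/big_rec2: _ => // x p q _; rewrite !oddD in_symdiff => ->.
by case: (x \in X); case: (x \in Y).
Qed.

Lemma even_zero_sum0 : even_zero_sum S (0 : pset _).
Proof. by rewrite /even_zero_sum sub0set cards0 big_set0 eqxx. Qed.

Lemma even_zero_sumD X Y :
  even_zero_sum S X -> even_zero_sum S Y -> even_zero_sum S (X + Y).
Proof.
case/and3P=> sX eX /eqP zX /and3P[sY eY /eqP zY].
rewrite /even_zero_sum -[X + Y]/(symdiff X Y) odd_symdiff sum_symdiff.
rewrite (negbTE eX) (negbTE eY) zX zY addr0 eqxx andbT.
by rewrite /symdiff (subset_trans (subsetDl _ _)) // subUset sX.
Qed.

Lemma mem_E X : (X \in E S) = even_zero_sum S X.
Proof.
apply/idP/idP=> [XE | ezX]; last by apply: memv_span; rewrite mem_enum.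
rewrite (coord_span (X := in_tuple _) XE).
apply: (big_ind (even_zero_sum S)) => [|Y Z|i _].
- exact: even_zero_sum0.
- exact: even_zero_sumD.
case: (F2_cases (coord (in_tuple _) i X)) => ->.
  by rewrite scale0r even_zero_sum0.
by rewrite scale1r; have := mem_nth 0 (ltn_ord i); rewrite mem_enum.
Qed.

End MemE.

(* The leading S :&: _ gives the intersection of the empty family (r = 0) its  *)
(* value S; it is redundant otherwise, when every member of X is a subset of S.*)
Definition venn (U : finType) (r : nat) (S : {set U}) (X : r.-tuple (pset U))
    (a : 'cV['F_2]_r) : {set U} :=
  S :&: \bigcap_(i < r | a i 0 == 1) (tnth X i : {set U})
    :&: \bigcap_(i < r | a i 0 != 1) (S :\: (tnth X i : {set U})).

(* v_X(a) |-> v_Y(N a) is a well-defined map on regions since regions with     *)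
(* distinct indices are distinct, possibly empty, points of Venn(S, V); it is  *)
(* linear and bijective for the addition v(a) + v(b) = v(a + b). Changing      *)
(* bases multiplies N by invertible matrices, so it does not matter which      *)
(* bases are taken; a common r forces \dim V = \dim W.                         *)
Definition venn_linear_bijection (U U' : finType)
    (S : {set U}) (V : {vspace pset U})
    (T : {set U'}) (W : {vspace pset U'}) : Prop :=
  exists (r : nat) (X : r.-tuple (pset U)) (Y : r.-tuple (pset U'))
         (N : 'M['F_2]_r),
    [/\ basis_of V X, basis_of W Y, N \in unitmx &
        forall a : 'cV['F_2]_r, #|venn T Y (N *m a)| = #|venn S X a|].

(* Main.v *)
(* A cardinality-preserving bijection of Venn regions is realised by a bijection
   phi : S -> T matching the regions. As the index map N is linear, phi carries
   linear combinations of the basis of E(S) to linear combinations of the basis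
   of E(T), so phi preserves and reflects even zero-sum subsets. Relative to a
   base point, the vectors of S and T then satisfy the same linear relations,
   and phi is the restriction of an affine automorphism. Conversely, pulling a
   basis of E(T) back along an affine automorphism gives a basis of E(S) with
   the same Venn regions, and N = 1 works. *)
Require Import Defs.
From HB Require Import structures.
From mathcomp Require Import all_boot all_order all_algebra.
Set Implicit Arguments. Unset Strict Implicit. Unset Printing Implicit Defensive.
Import GRing.Theory.
Local Open Scope ring_scope.

(** * Linear relations, affine maps and matching of fibres *)

Lemma F2_natrE (b : bool) : ((b%:R : 'F_2) == 1) = b.
Proof. by case: b. Qed.

Lemma mulrn_F2 n (x : 'cV['F_2]_n) k : x *+ k = x *+ odd k.
Proof.
by rewrite -[in LHS](odd_double_half k) mulrnDr -mul2n mulrnA mulr2n addvv_F2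
  mul0rn addr0.
Qed.

(** The columns of [cokermx A^T], transposed, lie in the left kernel of [A]. They therefore kill
    [B], so this cokernel kills [B^T]. *)
Lemma ker_sub_tr (F : fieldType) m n p (A : 'M[F]_(m, n)) (B : 'M[F]_(m, p)) :
  (forall c : 'rV_m, c *m A = 0 -> c *m B = 0) -> (B^T <= A^T)%MS.
Proof.
move=> kAB; rewrite submxE -[_ *m _]trmxK trmx_mul trmxK trmx_eq0.
apply/eqP/row_matrixP=> i; rewrite row_mul row0; apply: kAB.
have /(congr1 trmx) := mulmx_coker A^T; rewrite trmx_mul trmxK trmx0 => cA.
by rewrite -row_mul cA row0.
Qed.

Lemma same_ker_unitmx (F : fieldType) m n (A B : 'M[F]_(m, n)) :
    (forall c : 'rV_m, c *m A = 0 <-> c *m B = 0) ->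
  exists2 G : 'M_n, G \in unitmx & B^T = G *m A^T.
Proof.
move=> kAB; apply/eqmxMunitP/andP.
by split; apply: ker_sub_tr => c /kAB.
Qed.

(** In characteristic 2 an odd [Z] leaves one extra [f i0]; toggling [i0] in [Z] absorbs it and
    makes the cardinality even. [Z'] is chosen before [f], so it can serve two families at once. *)
Lemma even_translate (I : finType) (i0 : I) (Z : {set I}) :
  exists2 Z' : {set I}, ~~ odd #|Z'| &
    forall n (f : I -> 'cV['F_2]_n),
      \sum_(i in Z) (f i - f i0) = \sum_(i in Z') f i.
Proof.
have sumZ n (f : I -> 'cV['F_2]_n) :
    \sum_(i in Z) (f i - f i0) = \sum_(i in Z) f i + f i0 *+ odd #|Z|.
  rewrite sumrB sumr_const (mulrn_F2 (f i0) #|Z|); congr (_ + _); apply/eqP.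
  by rewrite eq_sym -addr_eq0 addvv_F2.
case oddZ: (odd #|Z|); last first.
  by exists Z => [|n f]; rewrite ?oddZ // sumZ oddZ addr0.
have [i0Z | i0Z] := boolP (i0 \in Z).
  exists (Z :\ i0) => [|n f]; first by move: oddZ; rewrite (cardsD1 i0) i0Z.
  by rewrite sumZ oddZ (big_setD1 i0) //= addrAC addvv_F2 add0r.
exists (i0 |: Z) => [|n f]; first by rewrite cardsU1 i0Z /= oddZ.
by rewrite sumZ oddZ big_setU1 //= addrC.
Qed.

(* The matrices with rows [f i - f i0] and [g i - g i0] have the same left
   kernel, hence differ by an invertible factor on the right. *)
Lemma same_relations_affine n m (f g : 'I_m -> 'cV['F_2]_n) :
    (forall Z : {set 'I_m}, ~~ odd #|Z| ->
       \sum_(i in Z) f i = 0 <-> \sum_(i in Z) g i = 0) ->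
  exists2 h, affine_automorphism h & forall i, g i = h (f i).
Proof.
case: m f g => [|m] f g fg.
  exists id => [|[]//]; exists 1%:M; first exact: unitmx1.
  by exists 0 => x; rewrite mul1mx addr0.
pose D (f : 'I_m.+1 -> 'cV['F_2]_n) := \matrix_i (f i - f ord0)^T.
have cD (c : 'rV_m.+1) e : c *m D e = (\sum_(i in [set i | c 0 i == 1]) (e i - e ord0))^T.
  rewrite mulmx_sum_row linear_sum [RHS]big_mkcond; apply: eq_bigr => i _ /=.
  rewrite inE rowK.
  by case: (F2_cases (c 0 i)) => ->; rewrite ?scale0r ?scale1r.
have [c | G uG DG] := @same_ker_unitmx _ _ _ (D f) (D g).
  (* A row [c] encodes an arbitrary set of indices, while [fg] speaks of even ones only; [Z']
     bridges the gap. *)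
  have [Z' evZ' sZ'] := even_translate ord0 [set i | c 0 i == 1].
  rewrite !cD !sZ'.
  by split=> /(congr1 trmx); rewrite trmxK trmx0 => /(fg _ evZ') ->; rewrite trmx0.
(* The translation part is forced by sending [f ord0] to [g ord0]. *)
exists (fun x => G *m x + (g ord0 - G *m f ord0)).
  by exists G => //; exists (g ord0 - G *m f ord0).
move=> i; apply/eqP; rewrite addrCA -mulmxBr addrC -subr_eq; apply/eqP.
by move/(congr1 (col i)): DG; rewrite !colE -mulmxA -!colE -!tr_row !rowK !trmxK.
Qed.

(** Elements at the same position in the enumerations of corresponding fibres are paired. *)
Lemma fibre_matching (U K : finType) (S T : {set U}) (h h' : U -> K) :
    (forall k, #|[set x in S | h x == k]| = #|[set y in T | h' y == k]|) ->
  exists2 phi : U -> U, {in S &, injective phi} /\ phi @: S = T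
    & {in S, forall x, h' (phi x) = h x}.
Proof.
move=> cardST.
pose A k := enum [set x in S | h x == k].
pose B k := enum [set y in T | h' y == k].
have szAB k : size (A k) = size (B k) by rewrite /A /B -!cardE cardST.
(* For [x] in [S] the index is in range, so the default [x] is never reached there. *)
pose phi x := nth x (B (h x)) (index x (A (h x))).
have memA x : x \in S -> x \in A (h x) by rewrite mem_enum inE eqxx andbT.
have ltB x : x \in S -> (index x (A (h x)) < size (B (h x)))%N.
  by move=> xS; rewrite -szAB index_mem memA.
have memB x : x \in S -> phi x \in B (h x) by move=> xS; apply/mem_nth/ltB.
have hphi : {in S, forall x, h' (phi x) = h x}.
  by move=> x /memB; rewrite mem_enum inE => /andP[_ /eqP].
have phiT x : x \in S -> phi x \in T.
  by move/memB; rewrite mem_enum inE => /andP[].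
have inj_phi : {in S &, injective phi}.
  move=> x y xS yS eq_phi.
  have eq_h : h x = h y by rewrite -hphi // eq_phi hphi.
  have := eq_phi; rewrite /phi eq_h (set_nth_default y) -?eq_h ?ltB // eq_h.
  move/eqP; rewrite nth_uniq ?enum_uniq ?ltB // -?eq_h ?ltB //.
  move/eqP=> eq_ix; rewrite -(nth_index x (memA _ xS)) eq_ix eq_h.
  by rewrite nth_index // memA.
exists phi => //; split=> //; apply/eqP; rewrite eqEcard.
apply/andP; split; first by apply/subsetP=> _ /imsetP[x xS ->]; apply: phiT.
rewrite card_in_imset // -!sum1_card.
rewrite (partition_big h' predT) // [leqRHS](partition_big h predT) //=.
by apply: leq_sum => k _; rewrite !sum1dep_card cardST.
Qed.

(** * Venn regions as fibres of an index map *)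

Section VennIndex.
Variables (U : finType) (r : nat).
Implicit Types (S Z : {set U}) (X : r.-tuple (pset U)).

Definition venn_index X (x : U) : 'cV['F_2]_r :=
  \col_i (x \in (tnth X i : {set U}))%:R.

Lemma vennE S X a : venn S X a = [set x in S | venn_index X x == a].
Proof.
apply/setP=> x; rewrite !inE -andbA; case xS: (x \in S) => //=.
apply/andP/eqP=> [[/bigcapP inX /bigcapP notX] | <-].
  apply/colP=> i; rewrite !mxE; case: (F2_cases (a i 0)) => ai.
    by have := notX i; rewrite ai inE => /(_ isT)/andP[/negbTE-> _].
  by rewrite inX ai.
by split; apply/bigcapP=> i; rewrite mxE F2_natrE // inE xS andbT.
Qed.

(** Symmetric difference adds indicator functions modulo 2, so the indicator of a linear combination
    is a linear functional of the index. *)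
Lemma mem_lincomb X (c : 'rV['F_2]_r) x :
  (x \in (\sum_i c 0 i *: tnth X i : pset U))%:R = (c *m venn_index X x) 0 0.
Proof.
rewrite mxE.
apply: (big_ind2 (fun (Z : pset U) (k : 'F_2) =>
          (x \in (Z : {set U}))%:R = k)) => [|Y k Z l <- <-|i _].
- by rewrite pset0E inE.
- rewrite -[Y + Z]/(symdiff Y Z) in_symdiff.
  by case: (x \in Y); case: (x \in Z); apply: val_inj.
rewrite mxE; case: (F2_cases (c 0 i)) => ->.
  by rewrite scale0r mul0r pset0E inE.
by rewrite scale1r mul1r.
Qed.

(** This form of membership can be transported: an invertible linear change of index only changes
    the functional [c]. *)
Lemma mem_basis_venn_index S (V : {vspace pset U}) X (Z : pset U) :
    basis_of V X -> (forall Y : pset U, Y \in V -> (Y : {set U}) \subset S) ->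
    (Z : {set U}) \subset S ->
  Z \in V <-> exists c : 'rV_r,
    {in S, forall x, (x \in (Z : {set U}))%:R = (c *m venn_index X x) 0 0}.
Proof.
move=> bX sV sZ; split=> [ZV | [c cZ]].
  exists (\row_i coord X i Z) => x _; rewrite -mem_lincomb.
  suff {1}-> : Z = \sum_i (\row_i coord X i Z) 0 i *: tnth X i by [].
  rewrite {1}(coord_basis bX ZV).
  by apply: eq_bigr => i _; rewrite mxE (tnth_nth 0).
have cV : \sum_i c 0 i *: tnth X i \in V.
  by apply: memv_suml => i _; apply/memvZ/(basis_mem bX)/mem_tnth.
suff -> : Z = \sum_i c 0 i *: tnth X i by [].
apply/setP=> x; case xS: (x \in S); last first.
  have outS (W : {set U}) : W \subset S -> (x \in W) = false.
    by move/subsetP/(_ x) => sW; apply: contraFF xS.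
  by rewrite (outS _ sZ) (outS _ (sV _ cV)).
by rewrite -[LHS]F2_natrE cZ // -mem_lincomb F2_natrE.
Qed.

End VennIndex.

Lemma E_sub n (S : {set 'cV['F_2]_n}) (X : pset 'cV['F_2]_n) :
  X \in E S -> (X : {set _}) \subset S.
Proof. by rewrite mem_E => /and3P[]. Qed.

(** * Pulling even zero-sum sets back along an affine automorphism *)

Section Preimage.
Variables (U U' : finType) (f : U -> U').

Definition pset_preim (Z : pset U') : pset U := f @^-1: (Z : {set U'}).

Fact pset_preim_linear : linear pset_preim.
Proof.
move=> a X Y; case: (F2_cases a) => ->; rewrite ?scale0r ?add0r ?scale1r //.
by apply/setP=> x; rewrite inE !in_symdiff !inE.
Qed.

HB.instance Definition _ :=
  GRing.isLinear.Build 'F_2 (pset U') (pset U) _ pset_preim pset_preim_linear.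

Lemma venn_preim r (T : {set U'}) (Y : r.-tuple (pset U')) a :
  venn (f @^-1: T) (map_tuple pset_preim Y) a = f @^-1: venn T Y a.
Proof.
rewrite !vennE; apply/setP=> x; rewrite !inE; congr (_ && (_ == a)).
by apply/colP=> i; rewrite !mxE tnth_map inE.
Qed.

End Preimage.

Lemma affine_automorphism_bij n (f : 'cV['F_2]_n -> 'cV['F_2]_n) :
  affine_automorphism f -> bijective f.
Proof.
case=> A uA [b fE]; apply: injF_bij => x y; rewrite !fE => /addIr.
by move/(congr1 (mulmx (invmx A))); rewrite !mulKmx.
Qed.

(** The translation [b] enters the sum once per element, so it cancels for even [Z] and the two sums
    differ by [A] alone. *)
Lemma mem_E_preim n (f : 'cV['F_2]_n -> 'cV['F_2]_n)
    (T : {set 'cV['F_2]_n}) (Z : pset 'cV['F_2]_n) :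
  affine_automorphism f -> (pset_preim f Z \in E (f @^-1: T)) = (Z \in E T).
Proof.
move=> aff_f; have bij_f := affine_automorphism_bij aff_f.
have [g fK gK] := bij_f; case: aff_f => A uA [b fE].
have cardZ : #|pset_preim f Z| = #|Z| := on_card_preimset (onW_bij _ bij_f).
rewrite !mem_E /even_zero_sum cardZ.
have -> : (f @^-1: Z \subset f @^-1: T) = (Z \subset T).
  apply/idP/idP=> [sZT | ]; last exact: preimsetS.
  by apply/subsetP=> y; have /subsetP/(_ (g y)) := sZT; rewrite !inE gK.
case evZ: (odd #|Z|) => //=.
have -> : \sum_(y in Z) y = A *m \sum_(x in pset_preim f Z) x.
  rewrite (reindex f) /=; last exact: onW_bij.
  rewrite mulmx_sumr (eq_bigl (mem (pset_preim f Z))); last by move=> x; rewrite !inE.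
  under eq_bigr do rewrite fE.
  by rewrite big_split /= sumr_const cardZ (mulrn_F2 b) evZ addr0.
congr (_ && _); apply/eqP/eqP=> [-> | /(congr1 (mulmx (invmx A)))].
  by rewrite mulmx0.
by rewrite mulKmx // mulmx0.
Qed.

Lemma affinely_equivalent_venn n (S T : {set 'cV['F_2]_n}) :
  affinely_equivalent S T -> venn_linear_bijection S (E S) T (E T).
Proof.
case=> f aff_f fST; have bij_f := affine_automorphism_bij aff_f.
have defS : S = f @^-1: T.
  by apply/setP=> x; rewrite inE -fST mem_imset //; apply: bij_inj.
have bT := vbasisP (E T).
exists (\dim (E T)), (map_tuple (pset_preim f) (vbasis (E T))),
  (vbasis (E T)), 1%:M; split=> [|//||a]; last first.
- by rewrite mul1mx defS venn_preim on_card_preimset //; apply: onW_bij.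
- exact: unitmx1.
have [g fK gK] := bij_f.
pose p := linfun (pset_preim f).
have pE Z : p Z = pset_preim f Z by rewrite lfunE.
have -> : E S = (p @: E T)%VS.
  apply/vspaceP=> Z; apply/idP/memv_imgP=> [ZS | [Y YT ->]]; last first.
    by rewrite pE defS mem_E_preim.
  have ZE : Z = pset_preim f (g @^-1: (Z : {set _})).
    by apply/setP=> x; rewrite !inE fK.
  exists (g @^-1: (Z : {set _}) : pset _); last by rewrite pE.
  by rewrite -(mem_E_preim _ _ aff_f) -ZE -defS.
have -> : map_tuple (pset_preim f) (vbasis (E T)) = map p (vbasis (E T)) :> seq _.
  by apply: eq_map => Z /=; rewrite pE.
apply: limg_basis_of => //; apply/eqP; rewrite -subv0.
(* Surjectivity of [f] makes taking preimages injective, so the basis stays a basis. *)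
suff /eqP-> : lker p == 0%VS by rewrite capv0.
apply/lker0P=> Y Z; rewrite !pE => /setP YZ; apply/setP=> y.
by have := YZ (g y); rewrite !inE gK.
Qed.

(** * From matching regions to an affine automorphism *)

Lemma venn_affinely_equivalent n (S T : {set 'cV['F_2]_n}) :
  venn_linear_bijection S (E S) T (E T) -> affinely_equivalent S T.
Proof.
case=> r [X [Y [N [bX bY uN cardN]]]].
(* Twisting the index on [T] by [invmx N] makes its fibre over [k] the region of index [N *m k],
   whose size [cardN] provides. *)
have [k | phi [inj_phi phiST] phiX] :=
  @fibre_matching _ _ S T (venn_index X) (fun y => invmx N *m venn_index Y y).
  rewrite -vennE -cardN vennE; apply: eq_card => y; rewrite !inE.
  by congr (_ && _); apply/eqP/eqP=> [-> | <-]; rewrite ?mulKmx ?mulKVmx.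
have phiE (Z : pset _) : (Z : {set _}) \subset S ->
    Z \in E S <-> (phi @: (Z : {set _}) : pset _) \in E T.
  move=> sZS.
  have sphi : phi @: (Z : {set _}) \subset T by rewrite -phiST imsetS.
  have memphi x : x \in S -> (phi x \in phi @: (Z : {set _})) = (x \in (Z : {set _})).
    move=> xS; apply/imsetP/idP=> [[y yZ] | xZ]; last by exists x.
    by move/inj_phi=> -> //; apply: (subsetP sZS).
  apply: iff_trans (mem_basis_venn_index bX (@E_sub _ S) sZS) _.
  apply: iff_trans (iff_sym (mem_basis_venn_index bY (@E_sub _ T) sphi)).
  (* By [phiX], the functional [c] on indices in [S] corresponds to [c *m invmx N] on indices in
     [T]. *)
  split=> -[c cZ].
    exists (c *m invmx N) => y; rewrite -phiST => /imsetP[x xS ->].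
    by rewrite memphi // cZ // -mulmxA phiX.
  exists (c *m N) => x xS; rewrite -memphi // cZ; last by rewrite -phiST imset_f.
  by rewrite -phiX // !mulmxA mulmxK.
(* Enumerating [S] turns sets of row indices into subsets of [S] with the same cardinality and sum,
   to which [phiE] applies. *)
have [Z evZ | h aff_h hE] := @same_relations_affine n #|S| enum_val (phi \o enum_val).
  have injv : {in Z &, injective (@enum_val _ (mem S))} by move=> ? ? _ _ /enum_val_inj.
  have sZ : enum_val @: Z \subset S.
    by apply/subsetP=> _ /imsetP[i _ ->]; apply: enum_valP.
  have injp : {in enum_val @: Z &, injective phi}.
    by move=> x y /(subsetP sZ) xS /(subsetP sZ) yS; apply: inj_phi.
  have sphi : phi @: (enum_val @: Z) \subset T by rewrite -phiST imsetS.
  have := phiE _ sZ; rewrite !mem_E /even_zero_sum sZ sphi (card_in_imset injp).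
  rewrite (card_in_imset injv) evZ /= (big_imset _ injp) (big_imset _ injv) /=.
  rewrite (big_imset _ injv) /=.
  by move=> H; split=> /eqP/H/eqP.
exists h => //; rewrite -phiST; apply: eq_in_imset => x xS.
by rewrite -(enum_rankK_in xS xS) -hE.
Qed.

Theorem theorem5p7 (n : nat) (S T : {set 'cV['F_2]_n}) :
  affinely_equivalent S T <-> venn_linear_bijection S (E S) T (E T).
Proof.
by split; [apply: affinely_equivalent_venn | apply: venn_affinely_equivalent].
Qed.
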